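(* Let $\lambda$ be a totally real algebraic integer with $[\mathbb{Q}(\lambda^2):\mathbb{Q}]=2$. Then $\lambda\in\mathcal{A}_2$.
   Context: An algebraic integer is totally real if all roots of its minimal polynomial over $\mathbb{Q}$ are real. The eigenvalues of a graph are the eigenvalues of its adjacency matrix. A rooted tree has height $h$ if the maximum distance from the root to a vertex is $h$. The arboreal height of a totally real algebraic integer $\lambda$ is the least $h$ such that some rooted tree of height $h$ has $\lambda$ as an eigenvalue; $\mathcal{A}_h$ denotes the set of totally real algebraic integers of arboreal height exactly $h$. *)

(* Defs.v *)
From HB Require Import structures.
From mathcomp Require Import all_boot all_order all_algebra all_field.

Set Implicit Arguments.
Unset Strict Implicit.
Unset Printing Implicit Defensive.

Import Order.TTheory GRing.Theory Num.Theory.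
Local Open Scope ring_scope.

Definition totally_real_integer (x : algC) : Prop :=
  x \in Aint /\ forall z : algC, root (minCpoly x) z -> z \is Num.real.

(* The field Q(x) as an abstract number field; by numfieldP it embeds in algC
   and is generated over Q by the preimage of x. *)
Definition numfield (x : algC) : fieldExtType rat :=
  projT1 (num_field_exists [:: x]).

Lemma numfieldP (x : algC) :
  {f : {rmorphism numfield x -> algC} &
    {y : numfield x | f y = x & <<1; y>>%VS = fullv}}.
Proof.
rewrite /numfield; case: (num_field_exists _) => K [f [[|y []] //= [Dy] genK]].
by exists f, y; rewrite // -genK span_seq1.
Qed.

Definition numfield_degree (x : algC) : nat := \dim {: numfield x}.

(* In a simple graph the cyclic sequence [:: x; y] along an edge is a ucycle,
   so genuine graph cycles are the ucycles with at least three vertices. *)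
Record is_tree (T : finType) (e : rel T) : Prop := IsTree {
  tree_sym : symmetric e;
  tree_irrefl : irreflexive e;
  tree_connected : forall x y : T, connect e x y;
  tree_acyclic : forall c : seq T, ucycle e c -> (size c < 3)%N
}.

(* A shortest path has fewer than #|T| edges, so searching lengths below #|T|
   is enough; the value is #|T| when y is not reachable from x. *)
Definition dist (T : finType) (e : rel T) (x y : T) : nat :=
  find (fun n => [exists p : n.-tuple T, path e x p && (last x p == y)])
       (iota 0 #|T|).

Definition height (T : finType) (e : rel T) (r : T) : nat :=
  \max_(v : T) dist e r v.

Definition adjacency (T : finType) (e : rel T) : 'M[algC]_#|T| :=
  \matrix_(i, j) (e (enum_val i) (enum_val j))%:R.

Definition rooted_tree_eigenvalue (h : nat) (x : algC) : Prop :=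
  exists (T : finType) (e : rel T) (r : T),
    [/\ is_tree e, height e r = h & eigenvalue (adjacency e) x].

Definition arboreal_height (x : algC) (h : nat) : Prop :=
  rooted_tree_eigenvalue h x /\
  forall k : nat, rooted_tree_eigenvalue k x -> (h <= k)%N.

Definition in_arboreal_class (h : nat) (x : algC) : Prop :=
  totally_real_integer x /\ arboreal_height x h.

(* Main.v *)
(* A root with n_k children carrying k leaves each has x as an eigenvalue as soon
   as y = x^2 satisfies [sum_k n_k / (y - k) = 1]. Here y is a root of an
   integral polynomial f(t) = t^2 - a t + b with two positive real roots, because
   the conjugates of y are squares of the (real) conjugates of x. The discriminant
   is neither 0 nor 1, so f is negative at the integer j = floor(a/2), and the values
   1 / f(k) then have both signs, which makes the equation solvable with n_k >= 0.
   A tree of height at most 1 is a star, whose eigenvalues have rational squares. *)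
Require Import Defs.
From mathcomp Require Import all_boot all_order all_algebra all_field.
From mathcomp Require Import zify ring.
Import Order.TTheory GRing.Theory Num.Theory.

Local Open Scope ring_scope.

(** * Eigenvectors as functions on vertices; trees of height at most 1 *)

Lemma eigenvalue_adjacencyP (T : finType) (e : rel T) (x : algC) :
  eigenvalue (adjacency e) x <->
  exists2 g : T -> algC, (exists u, g u != 0)
    & forall u, x * g u = \sum_(w | e w u) g w.
Proof.
have sumE (v : 'rV_#|T|) j : (v *m adjacency e) 0 j
    = \sum_(w | e w (enum_val j)) v 0 (enum_rank w).
  rewrite mxE [RHS]big_mkcond [RHS](reindex_onto enum_val enum_rank) /=; last first.
    by move=> i _; apply: enum_rankK.
  apply: eq_big => [i | i _]; first by rewrite enum_valK eqxx.
  by rewrite mxE enum_valK; case: ifP; rewrite ?mulr1 ?mulr0.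
split=> [/eigenvalueP[v vx /rV0Pn[i vi]] | [g [u gu] gx]].
  exists (fun u => v 0 (enum_rank u)) => [|u].
    by exists (enum_val i); rewrite enum_valK.
  by have /rowP/(_ (enum_rank u)) := vx; rewrite sumE enum_rankK mxE.
apply/eigenvalueP; exists (\row_i g (enum_val i)); last first.
  by apply/rV0Pn; exists (enum_rank u); rewrite mxE enum_rankK.
apply/rowP => j; rewrite sumE !mxE gx; apply: eq_bigr => w _.
by rewrite mxE enum_rankK.
Qed.

Lemma dist_le1 (T : finType) (e : rel T) (r v : T) :
  (dist e r v <= 1)%N -> v = r \/ e r v.
Proof.
(* A failed search returns [#|T|], which the bound allows only for a single vertex; otherwise it
   stops at length 0 or 1. *)
rewrite /dist; case: findP => [_ | i lti /(_ 0%N) Hi _ le1].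
  by rewrite size_iota => /fintype_le1P/(_ v r); left.
rewrite size_iota in lti; rewrite nth_iota // add0n in Hi.
case: i le1 {lti} Hi => [|[|//]] _ /existsP[p].
  by rewrite tuple0 => /eqP <-; left.
by case/tupleP: p => w p; rewrite tuple0 /= andbT => /andP[rw /eqP <-]; right.
Qed.

(** Each leaf [w] of the star satisfies [x * g w = g r]. Multiplying the root equation by [x] then
    makes [x ^+ 2] the number of leaves if [g r != 0]; if [g r = 0], a leaf with nonzero value
    forces [x = 0]. *)
Lemma height_le1_eigenvalue (h : nat) (x : algC) :
  (h <= 1)%N -> rooted_tree_eigenvalue h x -> x ^+ 2 \in Crat.
Proof.
move=> h1 [T [e [r [[sym irr _ acyc] eh]]]] /eigenvalue_adjacencyP[g [u gu] gx].
have adj w : w != r -> e r w.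
  move=> wr; case: (@dist_le1 _ e r w) => [|wr'|//].
    by apply: leq_trans h1; rewrite -eh; apply: leq_bigmax.
  by rewrite wr' eqxx in wr.
have leaf w : w != r -> x * g w = g r.
  move=> wr; rewrite gx (big_pred1 r) // => z; apply/idP/eqP => [ezw | ->].
    have zw : z != w by apply: contraTneq ezw => ->; rewrite irr.
    (* An edge between two non-root vertices would close a triangle through the root. *)
    apply: contraTeq isT => zr; suff /acyc : ucycle e [:: r; z; w] by [].
    rewrite /ucycle /= !inE ezw adj // (sym w) adj //= negb_or.
    by rewrite zw andbT !(eq_sym r) zr wr.
  exact: adj.
have rx : x ^+ 2 * g r = #|[pred w | e w r]|%:R * g r.
  rewrite expr2 -mulrA gx mulr_sumr mulr_natl -sumr_const.
  apply: eq_bigr => w ewr; apply: leaf.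
  by apply: contraTneq ewr => ->; rewrite irr.
have [gr0 | gr] := eqVneq (g r) 0; last first.
  by rewrite (mulIf gr rx) rpred_nat.
have ur : u != r by apply: contraNneq gu => ->; rewrite gr0.
have /eqP := leaf u ur; rewrite gr0 mulf_eq0 (negPf gu) orbF => /eqP ->.
by rewrite expr0n rpred0.
Qed.

(** * Trees given by a parent map *)

(** The root will be its own parent; [x != y] excludes the loop there. *)
Definition parent_rel {T : finType} (par : T -> T) : rel T :=
  fun x y => (x != y) && ((y == par x) || (x == par y)).

(** On a cycle with at least three vertices, both neighbours of a deepest vertex would be its
    parent, hence equal. Following parents connects every vertex to the root. *)
Lemma parent_rel_tree (T : finType) (par : T -> T) (d : T -> nat) (r : T) :
    par r = r -> (forall x, x != r -> d x = (d (par x)).+1) ->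
  is_tree (parent_rel par).
Proof.
move=> parr dS.
have sym : symmetric (parent_rel par).
  by move=> x y; rewrite /parent_rel eq_sym orbC.
have up x y : parent_rel par x y -> (d y <= d x)%N -> y = par x.
  case/andP=> neq /orP[/eqP // | /eqP xE].
  rewrite dS -?xE ?ltnn //.
  by apply: contra neq => /eqP yr; rewrite xE yr parr.
have conn x : connect (parent_rel par) x r.
  have [n] := ubnP (d x); elim: n x => // n IHn x dx.
  have [-> // | xr] := eqVneq x r; rewrite dS // in dx.
  apply: (connect_trans _ (IHn _ dx)); apply: connect1.
  rewrite /parent_rel eqxx andbT; apply/eqP => xE.
  by move: (dS x xr); rewrite -xE => /n_Sn.
split=> // [x|x y|c].
- by rewrite /parent_rel eqxx.
- apply: (connect_trans (conn x)); by rewrite sym_connect_sym.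
rewrite ltnNge => uc; apply/negP => c3.
have [x0 c0] : exists x0, x0 \in c.
  by case: c c3 {uc} => // x0 c _; exists x0; rewrite mem_head.
case: (arg_maxnP d c0) => x xc xmax.
have {}xmax y : y \in c -> (d y <= d x)%N by apply: xmax.
have [i s cE] := rot_to xc.
have sz : (2 < size (x :: s))%N by rewrite -cE size_rot.
have mems y : y \in s -> (d y <= d x)%N.
  by move=> ys; apply: xmax; rewrite -(mem_rot i) cE in_cons ys orbT.
move: uc; rewrite -(rot_ucycle i) cE /ucycle.
case: s sz mems {cE} => // y; elim/last_ind => // s z _ _ mems.
rewrite /= rcons_path last_rcons => /andP[/andP[exy /andP[_ ezx]]].
have yx : y = par x by apply: up => //; apply: mems; rewrite mem_head.
have zx : z = par x.
  by apply: up; rewrite 1?sym // mems // in_cons mem_rcons mem_head orbT.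
by rewrite yx -zx mem_rcons mem_head /= andbF.
Qed.

(** The parent chain gives a path of length [d x], and none is shorter because depth grows by at
    most one along an edge. The bound on [d x] keeps it among the lengths that [dist] searches. *)
Lemma parent_rel_dist (T : finType) (par : T -> T) (d : T -> nat) (r : T) :
    par r = r -> d r = 0%N -> (forall x, x != r -> d x = (d (par x)).+1) ->
  forall x, (d x < #|T|)%N -> dist (parent_rel par) r x = d x.
Proof.
move=> parr dr dS x ltx.
have down n y : d y = n -> exists p : n.-tuple T,
    path (parent_rel par) r p && (last r p == y).
  elim: n y => [|n IHn] y dy.
    exists [tuple] => /=; apply: contra_eqT dy; rewrite eq_sym => /dS ->.
    by [].
  have yr : y != r by apply: contra_eqN dy => /eqP ->; rewrite dr.
  have := dS y yr; rewrite dy => -[/esym dpy].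
  have [p /andP[pp /eqP lp]] := IHn _ dpy.
  exists [tuple of rcons p y]; rewrite /= rcons_path last_rcons pp lp eqxx andbT.
  rewrite /parent_rel eqxx orbT andbT; apply/eqP => yE.
  by move: dpy; rewrite yE dy => /esym/n_Sn.
have lipschitz p y : path (parent_rel par) y p ->
    (d (last y p) <= d y + size p)%N.
  elim: p y => [|z p IHp] y /=; first by rewrite addn0.
  case/andP=> /andP[yz /orP e] /IHp le; apply: leq_trans le _.
  rewrite addnS -addSn leq_add2r.
  case: e => /eqP E; rewrite E in yz *.
    have [yr | /dS ->] := eqVneq y r; last by rewrite !leqW.
    by rewrite yr parr.
  have [zr | /dS -> //] := eqVneq z r.
  by rewrite zr parr leqnSn.
pose a n := [exists p : n.-tuple T, path (parent_rel par) r p && (last r p == x)].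
have found n : a n -> (d x <= n)%N.
  move=> /existsP[p /andP[/lipschitz le /eqP lx]].
  by move: le; rewrite lx dr size_tuple.
rewrite /dist -/a; apply/eqP; rewrite eqn_leq.
have ax : a (d x) by apply/existsP; apply: down.
apply/andP; split.
  rewrite leqNgt; apply/negP => /(before_find 0%N).
  by rewrite nth_iota // ax.
have hasa : has a (iota 0 #|T|).
  by apply/hasP; exists (d x); rewrite // mem_iota.
have := hasa; rewrite has_find size_iota => lt.
by have := nth_find 0%N hasa; rewrite nth_iota //; apply: found.
Qed.

(** * Trees of height 2 *)

Lemma big_option (V : nmodType) (I : finType) (F : option I -> V) :
  \sum_o F o = F None + \sum_i F (Some i).
Proof.
rewrite (bigD1 None) //=; congr (_ + _).
by rewrite (reindex_omap Some id) => [|[]] //=; apply: eq_bigl => i; rewrite eqxx.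
Qed.

Lemma big_sigT (V : nmodType) (I : finType) (J : I -> finType)
    (F : {i : I & J i} -> V) :
  \sum_p F p = \sum_i \sum_(j : J i) F (existT _ i j).
Proof. by rewrite sig_big_dep; apply: eq_bigr => -[]. Qed.

(* [None] is the root, [(i, None)] its i-th child and [(i, Some l)] the l-th leaf
   hanging from that child. *)
Definition spider_vertex {m : nat} (k : 'I_m -> nat) : finType :=
  option {i : 'I_m & option 'I_(k i)}.

Definition spider_parent {m : nat} (k : 'I_m -> nat) (v : spider_vertex k) :
    spider_vertex k :=
  if v is Some (existT i (Some _)) then Some (existT _ i None) else None.

Definition spider_depth {m : nat} {k : 'I_m -> nat} (v : spider_vertex k) :=
  match v with
  | None => 0%N
  | Some (existT _ None) => 1%N
  | Some (existT _ (Some _)) => 2%N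
  end.

Lemma spider_eigenvalue (m : nat) (k : 'I_m -> nat) (x : algC) :
    (forall i, x ^+ 2 - (k i)%:R != 0) ->
    \sum_i (x ^+ 2 - (k i)%:R)^-1 = 1 ->
  eigenvalue (adjacency (parent_rel (spider_parent k))) x.
Proof.
move=> nz sum1; apply/eigenvalue_adjacencyP.
(* With root value 1, the leaf equation makes a child [x] times its leaf value, and the child
   equation then fixes the leaf value. The root equation is [x] times the assumed sum. *)
pose g (v : spider_vertex k) := match v with
  | None => 1
  | Some (existT i None) => x / (x ^+ 2 - (k i)%:R)
  | Some (existT i (Some _)) => (x ^+ 2 - (k i)%:R)^-1
  end.
have childE i i' : (Some (existT _ i None) == Some (existT _ i' None)
   :> spider_vertex k) = (i == i').
  by apply/eqP/eqP => [[] | ->].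
have leaf_child i l i' : (Some (existT _ i (Some l)) == Some (existT _ i' None)
    :> spider_vertex k) = false.
  by apply/eqP => /(congr1 (@spider_depth m k)).
have child_leaf i i' (l : 'I_(k i')) :
    (Some (existT _ i None) == Some (existT _ i' (Some l))
      :> spider_vertex k) = false.
  by rewrite eq_sym leaf_child.
have vertexE := (childE, leaf_child, child_leaf, andbF, andbT, orbF).
exists g => [|u]; first by exists None; rewrite oner_eq0.
rewrite big_mkcond big_option big_sigT.
under eq_bigr do rewrite big_option.
rewrite big_split /= /parent_rel /=.
case: u => [[i [l|]]|] /=.
- rewrite add0r [X in _ = _ + X]big1 ?addr0 => [|i' _]; last first.
    by apply: big1 => l' _; rewrite !vertexE.
  rewrite (bigD1 i) //= big1 => [|i' /negPf ii']; last by rewrite !vertexE ii'.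
  by rewrite !vertexE eqxx addr0.
- rewrite [X in _ = _ + (X + _)]big1 ?add0r => [|i' _]; last by rewrite !vertexE.
  rewrite (bigD1 i) //= [X in _ = _ + (_ + X)]big1 ?addr0 => [|i' /negPf ii'].
    under eq_bigr do rewrite !vertexE eqxx.
    by rewrite sumr_const card_ord -mulr_natl; field.
  by apply: big1 => l' _; rewrite !vertexE eq_sym ii'.
rewrite add0r [X in _ = _ + X]big1 ?addr0 => [|i _]; last by rewrite big1.
by rewrite -mulr_sumr sum1.
Qed.

(** The positive leaf count supplies a vertex of depth 2, so the height is exactly 2. *)
Lemma spider_rooted_tree_eigenvalue (ks : seq nat) (x : algC) :
    (exists2 n, n \in ks & (0 < n)%N) ->
    (forall n, n \in ks -> x ^+ 2 - n%:R != 0) ->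
    \sum_(n <- ks) (x ^+ 2 - n%:R)^-1 = 1 ->
  rooted_tree_eigenvalue 2 x.
Proof.
move=> [n nks n0] nz sum1; pose k (i : 'I_(size ks)) := nth 0%N ks i.
pose e := parent_rel (spider_parent k).
have parN : spider_parent k None = None by [].
have depthS (u : spider_vertex k) :
    u != None -> spider_depth u = (spider_depth (spider_parent k u)).+1.
  by case: u => [[i [l|]]|].
have depth2 (u : spider_vertex k) : (spider_depth u <= 2)%N.
  by case: u => [[i [l|]]|].
have [i ki] : exists i, k i = n.
  by have := nks; rewrite -index_mem => lti; exists (Ordinal lti); apply: nth_index.
have ltk : (0 < k i)%N by rewrite ki.
pose leaf : spider_vertex k := Some (existT _ i (Some (Ordinal ltk))).
have card (u : spider_vertex k) : (spider_depth u < #|spider_vertex k|)%N.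
  apply: leq_ltn_trans (depth2 u) _.
  (* Three vertices of distinct depths, so depth 2 is below the number of vertices. *)
  pose s : seq (spider_vertex k) := [:: None; Some (existT _ i None); leaf].
  have us : uniq (map (@spider_depth _ k) s) by [].
  by rewrite -[3%N]/(size s) -(card_uniqP (map_uniq us)) max_card.
have distE := parent_rel_dist _ _ _ _ parN (erefl _) depthS.
exists (spider_vertex k), e, None; split.
- exact: (parent_rel_tree _ _ _ _ parN depthS).
- apply/eqP; rewrite eqn_leq; apply/andP; split.
    by apply/bigmax_leqP => u _; rewrite distE ?card.
  by rewrite -[2%N]/(spider_depth leaf) -distE ?card // /height leq_bigmax.
apply: spider_eigenvalue; first by move=> j; apply: nz; apply: mem_nth.
by rewrite -[RHS]sum1 [RHS](big_nth 0%N) big_mkord.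
Qed.

(** * Arithmetic of [x] and [x^2] *)

(** Through the embedding [f], the minimal polynomials of [x] and of the field generator [y] divide
    each other. *)
Lemma size_minCpoly_numfield (x : algC) :
  size (minCpoly x) = (numfield_degree x).+1.
Proof.
have [f [y fy gen]] := numfieldP x.
have degy : adjoin_degree 1%AS y = numfield_degree x.
  by rewrite /numfield_degree -gen dim_Fadjoin dimv1 muln1.
have fA q : map_poly f (map_poly (in_alg (numfield x)) q) = map_poly ratr q.
  rewrite -map_poly_comp; apply: eq_map_poly => c.
  by rewrite /= alg_num_field fmorph_rat.
have [P [-> monP] dvdP] := minCpolyP x.
rewrite size_map_poly -degy -size_minPoly; apply/eqP; rewrite eqn_leq.
apply/andP; split.
  have [q defq] := polyOver1P (minPolyOver 1%AS y).
  have rootq : root (map_poly ratr q) x.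
    by have:= root_minPoly 1%AS y; rewrite -(fmorph_root f) fy defq fA.
  rewrite defq size_map_poly dvdp_leq -?dvdP //.
  apply: contraTneq (monic_minPoly 1%AS y) => q0.
  by rewrite defq q0 map_poly0 monicE lead_coef0 eq_sym oner_eq0.
rewrite -(size_map_poly (in_alg (numfield x)) P) dvdp_leq //.
  by rewrite map_poly_eq0 monic_neq0.
apply: minPoly_dvdp; first by apply/polyOver1P; exists P.
by rewrite -(fmorph_root f) fA fy dvdP.
Qed.

Lemma size_minCpoly_Crat (x : algC) : x \in Crat -> (size (minCpoly x) <= 2)%N.
Proof.
move=> /CratP[c ->]; have [P [-> monP] dvdP] := minCpolyP (ratr c).
rewrite size_map_poly; have /eq_leq/(leq_trans _) := size_XsubC c; apply.
rewrite dvdp_leq ?polyXsubC_eq0 //.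
by rewrite -dvdP fmorph_root root_XsubC.
Qed.

(* If [P = E(X^2) + X O(X^2)] is the minimal polynomial of [x], then
   [E(Y)^2 - Y O(Y)^2], which is [P(sqrt Y) P(- sqrt Y)], vanishes at [x^2]. *)
Lemma root_minCpoly_sqr (x z : algC) :
  root (minCpoly (x ^+ 2)) z -> exists2 w, root (minCpoly x) w & w ^+ 2 = z.
Proof.
have [P [PE _] _] := minCpolyP x; have [Q [-> _] dvdQ] := minCpolyP (x ^+ 2).
pose N := even_poly P ^+ 2 - 'X * odd_poly P ^+ 2.
have PE2 w : (map_poly ratr P).[w] = (map_poly ratr (even_poly P)).[w ^+ 2]
    + (map_poly ratr (odd_poly P)).[w ^+ 2] * w :> algC.
  rewrite -{1}(poly_even_odd P) rmorphD rmorphM /= !map_comp_poly.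
  by rewrite map_polyXn map_polyX !hornerE !horner_comp !hornerE.
have NE w : (map_poly ratr N).[w ^+ 2] =
    (map_poly ratr P).[w] * (map_poly ratr P).[- w] :> algC.
  rewrite !PE2 sqrrN rmorphB (rmorphM _ 'X) !rmorphXn /= map_polyX.
  by rewrite hornerD hornerN horner_exp hornerM hornerX horner_exp; ring.
have {PE2} QN : Q %| N.
  rewrite -dvdQ rootE NE (_ : (map_poly _ _).[x] = 0) ?mul0r //.
  by apply/rootP; rewrite -PE root_minCpoly.
move=> Qz; have /rootP : root (map_poly ratr N) z.
  by apply: root_dvdp Qz; rewrite dvdp_map.
rewrite -(sqrtCK z) NE => /eqP; rewrite mulf_eq0 PE => /orP[] rw.
  by exists (sqrtC z).
by exists (- sqrtC z); rewrite ?sqrrN.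
Qed.

Lemma quadratic_Aint (x : algC) :
  x \in Aint -> size (minCpoly x) = 3%N ->
  exists a b : int, forall z : algC,
    root (minCpoly x) z = (z ^+ 2 - a%:~R * z + b%:~R == 0).
Proof.
move=> /polyOverP intx sx; have /monicP := minCpoly_monic x.
rewrite lead_coefE sx /= => c2.
have /intrP[a aE] := intx 1%N; have /intrP[b bE] := intx 0%N.
exists (- a), b => z.
rewrite rootE horner_coef sx !big_ord_recl big_ord0 /= /bump /= c2 aE bE.
by rewrite intrN; congr (_ == _); ring.
Qed.

(** The last inequality says that [t^2 - a t + b] is negative at [a./2]: the discriminant exceeds 0
    for even [a], and 1 for odd [a]. *)
Lemma totally_real_sqr (x : algC) :
    totally_real_integer x -> numfield_degree (x ^+ 2) = 2%N ->
  exists a b : nat, [/\ x ^+ 4 = a%:R * x ^+ 2 - b%:R, (0 < b)%N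
    & (b + (a./2) ^ 2 < a * a./2)%N].
Proof.
move=> [xA xR] deg2; set y := x ^+ 2.
have sy : size (minCpoly y) = 3%N by rewrite size_minCpoly_numfield deg2.
have yA : y \in Aint by rewrite rpredX.
have [a [b abP]] := quadratic_Aint _ yA sy.
have yirr : y \notin Crat by apply/negP => /size_minCpoly_Crat; rewrite sy.
have y2 : y ^+ 2 - a%:~R * y + b%:~R = 0 by apply/eqP; rewrite -abP root_minCpoly.
(* The other conjugate of [y], nonnegative as the square of a real conjugate of [x]. *)
pose z : algC := a%:~R - y.
have zroot : root (minCpoly y) z by rewrite abP -y2; apply/eqP; rewrite /z; ring.
have [w rw wz] := root_minCpoly_sqr _ _ zroot.
have z0 : 0 <= z by rewrite -wz real_exprn_even_ge0 // xR.
have y0 : 0 <= y by rewrite real_exprn_even_ge0 // xR // root_minCpoly.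
have zirr : z \notin Crat.
  apply: contra yirr => zr; rewrite (_ : y = a%:~R - z); last by rewrite /z; ring.
  by rewrite rpredB // rpred_int.
have pos u : u \notin Crat -> 0 <= u -> 0 < u.
  by move=> uirr; rewrite le0r => /orP[/eqP u0 | //]; rewrite u0 rpred0 in uirr.
have yz : y * z = b%:~R by apply: subr0_eq; rewrite /z -[RHS]oppr0 -y2; ring.
have b0 : 0 < b by rewrite -(ltr0z algC) -yz mulr_gt0 ?pos.
have a0 : 0 < a.
  rewrite -(ltr0z algC).
  have <- : y + z = a%:~R by rewrite /z; ring.
  by rewrite addr_gt0 ?pos.
have DE : (y *+ 2 - a%:~R) ^+ 2 = (a ^+ 2 - 4 * b)%:~R.
  rewrite rmorphB rmorphXn rmorphM rmorph_nat /=; apply: subr0_eq.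
  by rewrite -[RHS](mulr0 4) -y2; ring.
have yR : y \is Num.real by apply: ger0_real.
have D0 : 0 <= a ^+ 2 - 4 * b.
  by rewrite -(ler0z algC) -DE real_exprn_even_ge0 // rpredB ?rpredMn ?realz.
(* A discriminant of 0 or 1 would make [y *+ 2] an integer and [y] rational. *)
have yI (c : int) : y *+ 2 = c%:~R -> False.
  move=> yc; move/negP: yirr; apply.
  rewrite (_ : y = c%:~R / 2) ?rpred_div ?rpred_int ?rpred_nat //.
  by rewrite -yc; field.
have D1 : a ^+ 2 - 4 * b <> 0.
  move=> D; move/eqP: DE; rewrite D expf_eq0 /= subr_eq0 => /eqP; exact: yI.
have D2 : a ^+ 2 - 4 * b <> 1.
  move=> D; move/eqP: DE; rewrite D sqrf_eq1.
  by case/orP => /eqP e; [apply: (yI (1 + a)) | apply: (yI (-1 + a))];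
    apply/eqP; rewrite intrD -subr_eq e.
case: a b a0 b0 D0 D1 D2 y2 {abP z zroot wz z0 zirr yz DE} => //.
move=> n [] // m n0 m0 D0 D1 D2 y2.
exists n, m; split; try nia.
by apply: subr0_eq; rewrite -[RHS]y2 /y; ring.
Qed.

(* With [f(t) = t^2 - a t + b] and [j = floor (a/2)], the leaf multiplicities are [a b]
   for [0], [- (a+1) f(j)] for [j] and [f(K)] for [K = (a+1) j - 1]; since
   [1 / (y - k) = (a - y - k) / f(k)], each block contributes an integral
   combination of [1] and [y]. *)
Lemma quadratic_leaf_counts (y : algC) (a b : nat) :
    y ^+ 2 = a%:R * y - b%:R -> (0 < b)%N -> (b + a./2 ^ 2 < a * a./2)%N ->
  exists ks : seq nat, [/\ exists2 n, n \in ks & (0 < n)%N,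
    forall n, n \in ks -> y - n%:R != 0
    & \sum_(n <- ks) (y - n%:R)^-1 = 1].
Proof.
set j := a./2 => y2 b0 ltj; have j0 : (0 < j)%N by case: j ltj => //; lia.
(* The three blocks weight [a - y] by [a], [- (a+1)] and 1, which cancel; the remainder
   [(a+1) j - K] is 1 for this [K]. *)
have [K KE] : exists K, (K.+1 = a.+1 * j)%N.
  by exists (a.+1 * j).-1; rewrite prednK // muln_gt0.
have aK : (a <= K)%N by rewrite -ltnS KE leq_pmulr.
pose nj := (a.+1 * (a * j - (b + j ^ 2)))%N; pose nK := (K * (K - a) + b)%N.
have nz n : (n ^ 2 + b != a * n)%N -> y - n%:R != 0.
  apply: contraNneq => /subr0_eq yn; move/eqP: y2.
  by rewrite yn eq_sym subr_eq -natrX -natrM -natrD eqr_nat eq_sym.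
(* Here [f(0) = b > 0], [f(j) < 0], and [f(K) >= b] because [K >= a]. *)
have nz0 : y - 0%:R != 0 by apply: nz; rewrite muln0 add0n -lt0n.
have nzj : y - j%:R != 0 by apply: nz; rewrite addnC ltn_eqF.
have nzK : y - K%:R != 0.
  apply: nz; rewrite gtn_eqF // (leq_ltn_trans (leq_mul aK (leqnn K))) //.
  by rewrite mulnn -addn1 leq_add2l.
exists (nseq (a * b) 0%N ++ nseq nj j ++ nseq nK K); split.
- exists j => //; rewrite !mem_cat !mem_nseq eqxx andbT.
  have -> : (0 < nj)%N by rewrite muln_gt0 subn_gt0 ltj.
  by rewrite orbT.
- by move=> n; rewrite !mem_cat !mem_nseq => /or3P[] /andP[_ /eqP ->].
have term n N z : y - n%:R != 0 -> N%:R = z * (y - n%:R) -> (y - n%:R)^-1 *+ N = z.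
  by move=> yn Nz; rewrite -[LHS]mulr_natl Nz mulfK.
have KR : K%:R = a.+1%:R * j%:R - 1 :> algC by rewrite -natrM -KE -natr1 addrK.
rewrite !big_cat !big_nseq !iter_addr_0 /=.
rewrite (term _ _ (a%:R * (a%:R - y))) //; last first.
  by rewrite natrM -[b%:R]opprK -[- b%:R](addKr (a%:R * y)) -y2; ring.
rewrite (term _ _ (- a.+1%:R * (a%:R - y - j%:R))) //; last first.
  rewrite natrM natrB 1?ltnW // natrD natrM natrX.
  by rewrite -[b%:R]opprK -[- b%:R](addKr (a%:R * y)) -y2; ring.
rewrite (term _ _ (a%:R - y - K%:R)) //; last first.
  rewrite natrD natrM natrB //.
  by rewrite -[b%:R]opprK -[- b%:R](addKr (a%:R * y)) -y2; ring.
by rewrite KR; ring.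
Qed.

Theorem theorem1 (lambda : algC)
  (lambda_tri : totally_real_integer lambda)
  (deg_lambda2 : numfield_degree (lambda ^+ 2) = 2%N) :
  in_arboreal_class 2 lambda.
Proof.
split=> //; split=> [|k treek]; last first.
  rewrite leqNgt; apply/negP => k1.
  have /size_minCpoly_Crat := height_le1_eigenvalue k lambda k1 treek.
  by rewrite size_minCpoly_numfield deg_lambda2.
have [a [b [quad b0 lt]]] := totally_real_sqr _ lambda_tri deg_lambda2.
have [|ks [ex nz sum1]] := quadratic_leaf_counts (lambda ^+ 2) a b _ b0 lt.
  by rewrite -exprM.
exact: spider_rooted_tree_eigenvalue ex nz sum1.
Qed.
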